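(* For all integers $p\ge 0$ and $n\ge 1$, $$\sum_{k=0}^n\binom{n}{k}F_k^{4p+1}=\left(\frac{1}{\sqrt5}\right)^{4p}\Bigg(\sum_{t=0}^{p-1}\binom{4p+1}{2t}F_{4p-4t+1}\Big\{\sum_{j=1}^{n-1}q(n-1,j)\,L_{(4p-4t+1)j}+q(n-1,0)\Big\}-(-1)^n\sum_{t=0}^{p-1}\binom{4p+1}{2t+1}F_{4p-4t-1}\Big\{\sum_{j=1}^{n-1}s(n-1,j)\,L_{(4p-4t-1)j}+s(n-1,0)\Big\}+\binom{4p+1}{2p}F_{2n}\Bigg).$$
   Context: $F_k$ and $L_k$ denote the Fibonacci and Lucas numbers: $F_0=0$, $F_1=1$, $L_0=2$, $L_1=1$, each satisfying $u_{k+2}=u_{k+1}+u_k$. For integers $n,c\ge 0$ define $$q(n,c)=\sum_{m=0}^n(-1)^m\binom{n+1}{2m+c+1},\qquad s(n,c)=(-1)^{n+c}\sum_{m=0}^n(-1)^m\binom{n+1}{2m+c+1},$$ where $\binom{N}{M}=0$ for $M>N\ge 0$. Empty sums are $0$. *)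

(* Defs.v *)
From mathcomp Require Import all_boot all_order all_algebra.

Set Implicit Arguments.
Unset Strict Implicit.
Unset Printing Implicit Defensive.

Import GRing.Theory Num.Theory.

Fixpoint fib (k : nat) : nat :=
  match k with
  | 0 => 0
  | (k'.+1 as k1).+1 => fib k1 + fib k'
  | 1 => 1
  end.

Fixpoint lucas (k : nat) : nat :=
  match k with
  | 0 => 2
  | (k'.+1 as k1).+1 => lucas k1 + lucas k'
  | 1 => 1
  end.

Local Open Scope ring_scope.

Definition q (n c : nat) : int :=
  \sum_(0 <= m < n.+1) (-1) ^+ m * 'C(n.+1, (2 * m + c + 1)%N)%:Z.

Definition s (n c : nat) : int :=
  (-1) ^+ (n + c) *
  \sum_(0 <= m < n.+1) (-1) ^+ m * 'C(n.+1, (2 * m + c + 1)%N)%:Z.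

(* Main.v *)
(** With [a], [b] the roots of [X^2 = X + 1], expand
    [(sqrt 5 F_k)^N = (a^k - b^k)^N] for [N = 4p+1] by the binomial theorem, pair
    the terms [i] and [N - i] using [a b = -1], and sum over [k] against
    ['C(n, k)]: the term [i] becomes
    [(-1)^i 'C(N, i) ((1 + (-1)^i a^r)^n - (1 + (-1)^i b^r)^n)] with [r = N - 2i].
    Both [(a^r, b^r)] and [(- a^r, - b^r)] have product [-1].  For [x y = -1], set
    [D_k = x^k - y^k]; then [(x - y) (x^j + y^j) = D_(j+1) + D_(j-1)], and since
    [q (n-1) j + q (n-1) (j+2) = 'C(n, j+1)], summation by parts yields
    [(1+x)^n - (1+y)^n = (x - y) (q (n-1) 0 + \sum_(j >= 1) q (n-1) j (x^j + y^j))].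
    The term [i = 2p] is [(1+a)^n - (1+b)^n = a^(2n) - b^(2n)]. *)
Require Import Defs.
From mathcomp Require Import all_boot all_order all_algebra.
From mathcomp Require Import ring lra zify.

Import Order.TTheory GRing.Theory Num.Theory.
Local Open Scope ring_scope.

(** The sums telescope: term [m] of [q n c.+2] cancels term [m.+1] of [q n c]. Only the term [m = 0]
    of [q n c] survives, as the last term of [q n c.+2] has its lower index above [n.+1]. *)
Lemma q_addSS (n c : nat) : q n c + q n c.+2 = 'C(n.+1, c.+1)%:Z.
Proof.
rewrite /q big_nat_recl // big_nat_recr //= expr0 mul1r.
rewrite [X in _ * X%:Z]bin_small; last by lia.
rewrite mulr0 addr0 -addrA -big_split /= big1_seq ?addr0.
  by congr ('C(_, _)%:Z); lia.
move=> m _; rewrite exprS mulN1r mulNr.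
by rewrite (_ : 2 * m.+1 + c + 1 = 2 * m + c.+2 + 1)%N ?addNr //; lia.
Qed.

Lemma q_eq0 (n c : nat) : (n < c)%N -> q n c = 0.
Proof.
move=> lt_nc; rewrite /q big1_seq // => m _.
by rewrite bin_small ?mulr0 //; lia.
Qed.

Lemma s_q (n c : nat) : s n c = (-1) ^+ (n + c) * q n c.
Proof. by []. Qed.

Section Lucas_sequences.
Variable R : comNzRingType.
Implicit Types x y : R.

(** Boundary terms are kept so that induction on [m] works for arbitrary [Q]; they vanish once [Q]
    is zero beyond [m]. *)
Lemma sum_by_parts_expB x y (Q : nat -> R) (m : nat) : x * y = -1 ->
  \sum_(0 <= k < m.+1) (Q k + Q k.+2) * (x ^+ k.+1 - y ^+ k.+1) =
  (x - y) * (\sum_(1 <= j < m.+1) Q j * (x ^+ j + y ^+ j) + Q 0)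
  + Q m.+1 * (x ^+ m - y ^+ m) + Q m.+2 * (x ^+ m.+1 - y ^+ m.+1).
Proof.
move=> xy; elim: m => [|m IHm].
  by rewrite big_nat1 big_geq // !expr0 !expr1; ring.
have step : (x - y) * (x ^+ m.+1 + y ^+ m.+1) =
    (x ^+ m.+2 - y ^+ m.+2) + (x ^+ m - y ^+ m).
  (* The cross terms [x * y ^+ m.+1 - y * x ^+ m.+1] factor through [x * y]. *)
  transitivity (x ^+ m.+2 - y ^+ m.+2 + (x * y) * (y ^+ m - x ^+ m)).
    by rewrite !exprS; ring.
  by rewrite xy; ring.
rewrite big_nat_recr //= IHm [in RHS]big_nat_recr //=.
rewrite [X in _ = X + _ + _]mulrDr [X in _ = X + _ + _ + _]mulrDr.
by rewrite [X in _ = _ + X + _ + _ + _]mulrCA step; ring.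
Qed.

Lemma expB_1D_q x y (n : nat) : x * y = -1 -> (1 <= n)%N ->
  (1 + x) ^+ n - (1 + y) ^+ n =
  (x - y) * (\sum_(1 <= j < n) (q (n - 1) j)%:~R * (x ^+ j + y ^+ j)
             + (q (n - 1) 0)%:~R).
Proof.
move=> xy; case: n => // n _; rewrite subSS subn0.
(* The terms of degree 0 in the two binomial expansions cancel, hence the shift to [k.+1]. *)
have -> : (1 + x) ^+ n.+1 - (1 + y) ^+ n.+1 =
    \sum_(0 <= k < n.+1) ('C(n.+1, k.+1)%:R : R) * (x ^+ k.+1 - y ^+ k.+1).
  rewrite !(exprDn 1) -!(big_mkord xpredT (fun i => _ ^+ (n.+1 - i) * _ ^+ i *+ 'C(n.+1, i))).
  rewrite big_nat_recl // [X in _ - X]big_nat_recl //= !expr0 !mulr1 opprD addrACA subrr add0r.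
  rewrite -sumrB; apply: eq_bigr => k _.
  by rewrite !expr1n !mul1r -mulrnBl mulr_natl.
transitivity (\sum_(0 <= k < n.+1)
    ((q n k)%:~R + (q n k.+2)%:~R : R) * (x ^+ k.+1 - y ^+ k.+1)).
  by apply: eq_bigr => k _; rewrite -intrD q_addSS.
rewrite (sum_by_parts_expB _ _ (fun k => (q n k)%:~R)) //.
by rewrite (@q_eq0 n n.+1) // (@q_eq0 n n.+2) // !mulr0z !mul0r !addr0.
Qed.

(** Apply the previous lemma to [- x] and [- y], whose product is also -1. The sign [(-1) ^+ j] of
    the powers turns [q] into [s], up to the global factor [(-1) ^+ n]. *)
Lemma expB_1B_s x y (n : nat) : x * y = -1 -> (1 <= n)%N ->
  (1 - x) ^+ n - (1 - y) ^+ n =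
  (-1) ^+ n * ((x - y) * (\sum_(1 <= j < n) (s (n - 1) j)%:~R * (x ^+ j + y ^+ j)
                          + (s (n - 1) 0)%:~R)).
Proof.
move=> xy n_gt0; rewrite expB_1D_q ?mulrNN // mulrCA -opprD mulNr -mulrN.
congr (_ * _).
case: n n_gt0 => // n _; rewrite subSS subn0 mulrDr mulr_sumr opprD -sumrN.
have sgn j : ((-1) ^+ n.+1 * (s n j)%:~R : R) = - ((-1) ^+ j * (q n j)%:~R).
  rewrite s_q intrM rmorphXn /= rmorphN1 exprD exprS !mulrA.
  by rewrite mulN1r !mulNr -expr2 sqrr_sign mul1r.
congr (_ + _); last by rewrite sgn expr0 mul1r.
apply: eq_bigr => j _.
by rewrite mulrA sgn [(- x) ^+ j]exprNn [(- y) ^+ j]exprNn; ring.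
Qed.

(** The top index stays apart: in the main sum it yields the isolated [fib (2 * n)] term. *)
Lemma big_split_parity (F : nat -> R) (p : nat) :
  \sum_(0 <= i < (2 * p).+1) F i =
  \sum_(0 <= t < p) F (2 * t)%N + \sum_(0 <= t < p) F (2 * t + 1)%N + F (2 * p)%N.
Proof.
elim: p => [|p IHp]; first by rewrite muln0 big_nat1 !big_geq // !add0r.
rewrite (_ : 2 * p.+1 = (2 * p).+2)%N; last by lia.
rewrite big_nat_recr //= big_nat_recr //= IHp [X in _ = X + _ + _]big_nat_recr //=.
rewrite [X in _ = _ + X + _]big_nat_recr //= addn1.
by ring.
Qed.

Lemma exprB_odd_paired x y (m : nat) :
  (x - y) ^+ (2 * m + 1) =
  \sum_(0 <= i < m.+1) (-1) ^+ i * 'C(2 * m + 1, i)%:R *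
     ((x * y) ^+ i * (x ^+ (2 * m + 1 - 2 * i) - y ^+ (2 * m + 1 - 2 * i))).
Proof.
rewrite exprBn -(big_mkord xpredT
  (fun i => (-1) ^+ i * x ^+ (2 * m + 1 - i) * y ^+ i *+ 'C(2 * m + 1, i))).
rewrite (big_cat_nat _ (n := m.+1)) //=; last by lia.
(* Reverse the upper half and shift it to start at 0: its term [i] is now the original term
   [2 * m + 1 - i]. *)
rewrite [X in _ + X]big_nat_rev /= -{2}[m.+1]add0n big_addn.
rewrite (_ : (2 * m + 1).+1 - m.+1 = m.+1)%N; last by lia.
rewrite -big_split /= big_nat_cond [RHS]big_nat_cond.
apply: eq_bigr => i /andP[/andP[_ lt_im] _].
rewrite (_ : m.+1 + (2 * m + 1).+1 - (i + m.+1).+1 = 2 * m + 1 - i)%N; last by lia.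
rewrite bin_sub; last by lia.
rewrite subKn; last by lia.
(* The exponent is odd, so paired terms carry opposite signs and form a difference. *)
have -> : (-1) ^+ (2 * m + 1 - i) = - (-1) ^+ i :> R.
  rewrite -signr_odd oddB; last by lia.
  by rewrite oddD mul2n odd_double /= signrN signr_odd.
rewrite (_ : 2 * m + 1 - i = i + (2 * m + 1 - 2 * i))%N; last by lia.
by rewrite -mulrnDl -mulr_natl !exprD exprMn; ring.
Qed.

(** Pairing leaves the factor [((-1) ^+ k) ^+ i], which equals [((-1) ^+ i) ^+ k]; it joins the
    [k]-th power, and the sum over [k] is a binomial expansion. *)
Lemma sum_bin_exp_odd x y (m n : nat) : x * y = -1 ->
  \sum_(0 <= k < n.+1) 'C(n, k)%:R * (x ^+ k - y ^+ k) ^+ (2 * m + 1) =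
  \sum_(0 <= i < m.+1) (-1) ^+ i * 'C(2 * m + 1, i)%:R *
     ((1 + (-1) ^+ i * x ^+ (2 * m + 1 - 2 * i)) ^+ n
      - (1 + (-1) ^+ i * y ^+ (2 * m + 1 - 2 * i)) ^+ n).
Proof.
move=> xy; under eq_bigr => k _ do
  rewrite exprB_odd_paired -exprMn xy mulr_sumr.
rewrite exchange_big /=; apply: eq_bigr => i _.
rewrite !(exprDn 1) -sumrB mulr_sumr big_mkord; apply: eq_bigr => k _.
rewrite -mulrnBl -[X in _ = _ * X]mulr_natl.
by rewrite !expr1n !exprMn -!exprM !(mulnC k); ring.
Qed.

End Lucas_sequences.

Section Binet.
Variable R : rcfType.

Lemma sqr_sqrt5 : Num.sqrt (5 : R) ^+ 2 = 5.
Proof. by rewrite sqr_sqrtr // ler0n. Qed.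

Let a : R := (1 + Num.sqrt 5) / 2.
Let b : R := (1 - Num.sqrt 5) / 2.

Lemma golden_sqr : a ^+ 2 = 1 + a.
Proof. by have := sqr_sqrt5; rewrite /a; lra. Qed.

Lemma golden_conj_sqr : b ^+ 2 = 1 + b.
Proof. by have := sqr_sqrt5; rewrite /b; lra. Qed.

Lemma golden_mul : a * b = -1.
Proof. by have := sqr_sqrt5; rewrite /a /b; lra. Qed.

Lemma fib_binet (k : nat) : Num.sqrt 5 * (fib k)%:R = a ^+ k - b ^+ k.
Proof.
suff [] : Num.sqrt 5 * (fib k)%:R = a ^+ k - b ^+ k /\
    Num.sqrt 5 * (fib k.+1)%:R = a ^+ k.+1 - b ^+ k.+1 by [].
elim: k => [|k [IH0 IH1]]; first by rewrite /= !expr0 !expr1 /a /b; split; lra.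
split=> //; rewrite [fib k.+2]/(fib k.+1 + fib k)%N natrD mulrDr IH0 IH1.
by rewrite -[k.+2]addn2 !(exprD _ k) golden_sqr golden_conj_sqr !exprS; ring.
Qed.

Lemma lucas_binet (k : nat) : (lucas k)%:R = a ^+ k + b ^+ k.
Proof.
suff [] : (lucas k)%:R = a ^+ k + b ^+ k /\
    (lucas k.+1)%:R = a ^+ k.+1 + b ^+ k.+1 by [].
elim: k => [|k [IH0 IH1]]; first by rewrite /= !expr0 !expr1 /a /b; split; lra.
split=> //; rewrite [lucas k.+2]/(lucas k.+1 + lucas k)%N natrD IH0 IH1.
by rewrite -[k.+2]addn2 !(exprD _ k) golden_sqr golden_conj_sqr !exprS; ring.
Qed.

(** All exponents [4 * p + 1 - 2 * i] that occur are odd, so the product -1 passes to these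
    powers. *)
Lemma golden_exp_odd_mul (r : nat) : odd r -> a ^+ r * b ^+ r = -1.
Proof. by move=> r_odd; rewrite -exprMn golden_mul -signr_odd r_odd. Qed.

Lemma golden_1D_q (r n : nat) : odd r -> (1 <= n)%N ->
  (1 + a ^+ r) ^+ n - (1 + b ^+ r) ^+ n =
  Num.sqrt 5 * (fib r)%:R *
    (\sum_(1 <= j < n) (q (n - 1) j)%:~R * (lucas (r * j))%:R + (q (n - 1) 0)%:~R).
Proof.
move=> r_odd n_gt0; rewrite expB_1D_q ?golden_exp_odd_mul // fib_binet.
by under [in RHS]eq_bigr => j _ do rewrite lucas_binet !exprM.
Qed.

Lemma golden_1B_s (r n : nat) : odd r -> (1 <= n)%N ->
  (1 - a ^+ r) ^+ n - (1 - b ^+ r) ^+ n =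
  (-1) ^+ n * (Num.sqrt 5 * (fib r)%:R *
    (\sum_(1 <= j < n) (s (n - 1) j)%:~R * (lucas (r * j))%:R + (s (n - 1) 0)%:~R)).
Proof.
move=> r_odd n_gt0; rewrite expB_1B_s ?golden_exp_odd_mul // fib_binet.
by under [in RHS]eq_bigr => j _ do rewrite lucas_binet !exprM.
Qed.

Lemma golden_1D_fib (n : nat) :
  (1 + a) ^+ n - (1 + b) ^+ n = Num.sqrt 5 * (fib (2 * n))%:R.
Proof. by rewrite fib_binet !exprM golden_sqr golden_conj_sqr. Qed.

Lemma sum_bin_sqrt5_fib (m n : nat) :
  Num.sqrt 5 ^+ (2 * m + 1) *
    \sum_(0 <= k < n.+1) 'C(n, k)%:R * (fib k)%:R ^+ (2 * m + 1) =
  \sum_(0 <= i < m.+1) (-1) ^+ i * 'C(2 * m + 1, i)%:R *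
     ((1 + (-1) ^+ i * a ^+ (2 * m + 1 - 2 * i)) ^+ n
      - (1 + (-1) ^+ i * b ^+ (2 * m + 1 - 2 * i)) ^+ n).
Proof.
rewrite -sum_bin_exp_odd ?golden_mul // mulr_sumr; apply: eq_bigr => k _.
by rewrite mulrCA -exprMn fib_binet.
Qed.

End Binet.

Theorem theorem4p1 (R : rcfType) (p n : nat) (n_ge1 : (1 <= n)%N) :
  \sum_(0 <= k < n.+1) 'C(n, k)%:R * (fib k)%:R ^+ (4 * p + 1) =
  (1 / Num.sqrt 5) ^+ (4 * p) *
  ( \sum_(0 <= t < p)
       'C(4 * p + 1, 2 * t)%:R * (fib (4 * p - 4 * t + 1))%:R *
       ( \sum_(1 <= j < n)
            (q (n - 1) j)%:~R * (lucas ((4 * p - 4 * t + 1) * j))%:R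
         + (q (n - 1) 0)%:~R )
    - (-1) ^+ n *
      \sum_(0 <= t < p)
       'C(4 * p + 1, 2 * t + 1)%:R * (fib (4 * p - 4 * t - 1))%:R *
       ( \sum_(1 <= j < n)
            (s (n - 1) j)%:~R * (lucas ((4 * p - 4 * t - 1) * j))%:R
         + (s (n - 1) 0)%:~R )
    + 'C(4 * p + 1, 2 * p)%:R * (fib (2 * n))%:R ) :> R.
Proof.
have w_neq0 : Num.sqrt 5 != 0 :> R by rewrite sqrtr_eq0 -ltNge ltr0n.
(* This factor cancels [(1 / Num.sqrt 5) ^+ (4 * p)] and leaves one [Num.sqrt 5] on the right, as
   needed by the Binet formula. *)
apply: (mulfI (expf_neq0 (4 * p + 1) w_neq0)).
rewrite [in RHS]exprD expr1 mulrA [X in _ = X * _]mulrAC -exprMn mul1r divff // expr1n mul1r.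
rewrite (_ : 4 * p = 2 * (2 * p))%N; last by lia.
rewrite sum_bin_sqrt5_fib big_split_parity [in RHS]mulrDr [in RHS]mulrBr.
(* The three goals are the even [i = 2 * t], the odd [i = 2 * t + 1], and [i = 2 * p], where the
   exponent is 1. *)
congr (_ + _ + _).
- rewrite mulr_sumr big_nat_cond [RHS]big_nat_cond.
  apply: eq_bigr => t /andP[/andP[_ lt_tp] _].
  rewrite exprM sqrrN expr1n expr1n !mul1r.
  rewrite (_ : 2 * (2 * p) + 1 - 2 * (2 * t) = 2 * (2 * p) - 4 * t + 1)%N; last by lia.
  by rewrite golden_1D_q //; [ring | lia].
- rewrite !mulr_sumr -sumrN big_nat_cond [RHS]big_nat_cond.
  apply: eq_bigr => t /andP[/andP[_ lt_tp] _].
  rewrite exprD exprM sqrrN expr1n expr1n expr1 mul1r !mulN1r.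
  rewrite (_ : 2 * (2 * p) + 1 - 2 * (2 * t + 1) = 2 * (2 * p) - 4 * t - 1)%N; last by lia.
  by rewrite golden_1B_s //; [ring | lia].
- rewrite exprM sqrrN expr1n expr1n !mul1r addKn !expr1.
  by rewrite golden_1D_fib; ring.
Qed.
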